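(* Let $\frac{3}{8} < s < \frac{1}{2}$ and $2(1-s) < \gamma < 1+\frac{2s}{3}$. Assume that the initial data $(\rho_0,u_0)$ on $[0,a_0]$ satisfy $$\int_0^{a_0} \rho_0\,d\xi = \int_0^{\bar{R}} \bar{\rho}\,dx, \quad \rho_0(a_0) = 0, \quad (\rho_0^{\gamma-1})'(a_0) = (\bar{\rho}^{\gamma-1})'(\bar{R}),$$ and the compatibility condition $u_0(0)=\partial_\xi u_0(a_0)=0$, and that they are a small perturbation of the steady state in the sense that $$\|(\partial_x \eta_0 - 1, \partial_x \eta_1)\|_{L^\infty(-\bar{R}, \bar{R})}^2 + \|\bar{\rho}^{\gamma - \frac{1}{2}} \partial_{xx} \eta_0\|_{L^2(-\bar{R}, \bar{R})}^2 + \|\bar{\rho}^{\frac{1}{2}} \partial_t \eta_1\|_{L^2(-\bar{R}, \bar{R})}^2 \leq \varepsilon_0$$ with $\varepsilon_0>0$ sufficiently small. Let $\eta$ be the unique global-in-time strong solution of the Lagrangian problem with data $(\eta_0,\eta_1)$, and define $$a(t):=\eta(t,\bar R),\qquad \rho(\tau,\xi):=\frac{\bar\rho(x)}{\partial_x\eta(\tau,x)},\qquad u(\tau,\xi):=\partial_\tau\eta(\tau,x),\qquad x=\eta^{-1}(\tau,\xi),$$ for $\tau\ge0$, $-a(\tau)\le\xi\le a(\tau)$. Then $(\rho,u,a)$ is the unique global strong solution to the free boundary problem $$\partial_\tau \rho + \partial_\xi (\rho u) = 0,\qquad \rho(\partial_\tau u + u \partial_\xi u) + \partial_\xi (\rho^\gamma)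 = \partial_{\xi\xi} u - \rho\, \partial_\xi \Psi,\qquad \tau>0,\ 0<\xi<a(\tau),$$ $$\frac{da(\tau)}{d\tau}=u(\tau,a(\tau)),\quad a(0)=a_0,\qquad (\rho,u)(0,\xi)=(\rho_0,u_0)(\xi),\qquad u(\tau,0)=0,\quad \partial_\xi u(\tau,a(\tau))=0.$$
   Context: Riesz kernel (dimension one): $W(x)=\frac{|x|^{2s-1}}{2s-1}$, $W'(x)=\frac{x}{|x|^{3-2s}}$ for $x\ne0$. Potential: $\partial_\xi\Psi(\tau,\xi)=\int_{-\infty}^\infty W'(\xi-\zeta)(\tilde\rho(\tau,\zeta)-\tilde\rho(\tau,\xi))\,d\zeta$, where $\rho$ is extended evenly (and $u$ oddly) to $[-a(\tau),a(\tau)]$ and $\tilde\rho$ is the extension of $\rho$ by $0$ outside $[-a(\tau),a(\tau)]$. $\rho_0$, $u_0$ are likewise extended evenly, resp. oddly, to $[-a_0,a_0]$. Steady state: $\bar\rho$ is the unique global minimiser of $\mathcal F[\rho]=\int_{\mathbb R}\frac{1}{\gamma-1}\rho^\gamma+\frac12\rho\,(W*\rho)\,dx$ over $\{\rho\in L^1(\mathbb R)\cap L^\gamma(\mathbb R):\rho\ge0,\ \|\rho\|_{L^1}=1,\ \int x\rho\,dx=0\}$. It is known (for $2(1-s)<\gamma\le2$) to be even, non-increasing in $|x|$, Lipschitz on $\mathbb R$, smooth inside its support $[-\bar R,\bar R]$ ($0<\bar R<\infty$), and to satisfy $(\bar\rho^\gamma)'(x)+\bar\rho(x)\int_{\mathbb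 R}W'(x-y)(\bar\rho(y)-\bar\rho(x))\,dy=0$. Lagrangian data: $\eta_0:[-\bar R,\bar R]\to[-a_0,a_0]$ is the odd map determined by $\int_{\eta_0(-x)}^{\eta_0(x)}\rho_0(y)\,dy=\int_{-x}^x\bar\rho(y)\,dy$, with $\eta_0'(\pm\bar R)=1$; $\eta_1(x):=u_0(\eta_0(x))$; $\partial_t\eta_1$ is defined by $\bar\rho\,\partial_t\eta_1:=-\partial_x\big[(\bar\rho/\partial_x\eta_0)^\gamma-\bar\rho^\gamma\big]-\Phi(0,\cdot)+\partial_x\big(\partial_x\eta_1/\partial_x\eta_0\big)$. Lagrangian problem: $\bar{\rho}\,\partial_{tt}\eta + \partial_x\big[(\bar{\rho}/\partial_x\eta)^\gamma - \bar{\rho}^\gamma\big] + \Phi = \partial_x\big(\partial_{tx}\eta/\partial_x\eta\big)$ on $t>0$, $-\bar R<x<\bar R$, with $\eta(0,\cdot)=\eta_0$, $\partial_t\eta(0,\cdot)=\eta_1$, $\partial_x\eta(t,\pm\bar R)=1$. Here $\Phi(t,x):=\partial_x(\bar\rho^\gamma(x))+\frac{\bar\rho(x)}{\partial_x\eta(t,x)}\int_{-\infty}^{\infty}W'(\eta(t,x)-\tilde\eta(t,y))\big(\bar\rho(y)\partial_x\eta(t,x)-\bar\rho(x)\partial_y\tilde\eta(t,y)\big)\,dy$, where $\tilde\eta(t,x)=-\eta(t,\bar R)+\bar R+x$ for $x<-\bar R$, $\tilde\eta(t,x)=-\eta(t,-x)$ for $-\bar R\le x<0$, $\tilde\eta(t,0)=0$,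 $\tilde\eta(t,x)=\eta(t,x)$ for $0<x\le\bar R$, $\tilde\eta(t,x)=\eta(t,\bar R)-\bar R+x$ for $x>\bar R$. Strong solution of the Lagrangian problem on $[0,T]\times[-\bar R,\bar R]$: (1) $c_1\le\partial_x\eta\le c_2$ for some constants $c_1,c_2>0$; (2) $\partial_t\eta\in C([0,T];W^{1,\infty}(-\bar R,\bar R))$; (3) $\bar\rho^{\frac12}\partial_t\eta\in C^1([0,T];L^2(-\bar R,\bar R))$, $\bar\rho^{\gamma-\frac12}\partial_{xx}\eta\in C([0,T];L^2(-\bar R,\bar R))$ and $\bar\rho^{-\frac12}\partial_x\big(\frac{\partial_{tx}\eta}{\partial_x\eta}\big)\in C([0,T];L^2(-\bar R,\bar R))$; (4) $\partial_x\eta(t,\pm\bar R)=1$ in the sense of $H^1$-trace for $0\le t\le T$; (5) the equation holds a.e.; and the initial conditions hold. Under the stated smallness (for $\varepsilon_0$ small) the Lagrangian problem has a unique strong solution on $[0,T]$ for every $T>0$. Strong solution of the free boundary problem: $(\rho,u,a)$ is called a strong solution on $[0,T]$ if there is a strong solution $\eta$ of the Lagrangian problem such that $a(t)=\eta(t,\bar R)$ and $\rho(\tau,\xi)=\bar\rho(x)/\partial_x\eta(\tau,x)$, $u(\tau,\xi)=\partial_\tau\eta(\tau,x)$ with $x=\eta^{-1}(\tau,\xi)$, a.e. Global means for every $T>0$. *)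

(* Defs.v *)
From HB Require Import structures.
From mathcomp Require Import all_boot all_order all_algebra.
From mathcomp Require Import all_classical all_reals all_analysis.
Set Implicit Arguments.
Unset Strict Implicit.
Unset Printing Implicit Defensive.
Import Order.TTheory GRing.Theory Num.Theory.
Import numFieldNormedType.Exports.
Local Open Scope classical_set_scope.
Local Open Scope ring_scope.

(* [f] has derivative [l] at [x] along [A]: one-sided at an endpoint of an
   interval [A], two-sided in its interior. *)
Definition deriv_within (R : realType) (A : set R) (f : R -> R) (x l : R) : Prop :=
  (fun h => h^-1 * (f (x + h) - f x)) @ within [set h | A (x + h)] 0^' --> l.

(* Test functions of class C^1 with compact support in the open set [D]; in
   dimension one these define the same weak derivatives as C^oo test functions. *)
Definition test_function (R : realType) (D : set R) (phi : R -> R) : Prop :=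
  [/\ forall x, derivable phi x 1,
      continuous (derive1 phi) &
      exists K, [/\ compact K, K `<=` D & forall x, ~ K x -> phi x = 0]].

Definition is_weak_derivative (R : realType) (D : set R) (f g : R -> R) : Prop :=
  [/\ locally_integrable D f, locally_integrable D g &
      forall phi, test_function D phi ->
        Rintegral lebesgue_measure D (fun x => f x * derive1 phi x) =
        - Rintegral lebesgue_measure D (fun x => g x * phi x)].

Definition weakly_derivable (R : realType) (D : set R) (f : R -> R) : Prop :=
  exists g, is_weak_derivative D f g.

(* A representative of the weak derivative; it is only used up to null sets. *)
Definition wderiv (R : realType) (D : set R) (f : R -> R) : R -> R :=
  xget (fun=> 0) [set g | is_weak_derivative D f g].

Definition L2norm (R : realType) (D : set R) (f : R -> R) : \bar R :=
  Lnorm lebesgue_measure 2%:E (EFin \o (f \_ D)).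

Definition Linfnorm (R : realType) (D : set R) (f : R -> R) : \bar R :=
  Lnorm lebesgue_measure +oo%E (EFin \o (f \_ D)).

Definition inL2 (R : realType) (D : set R) (f : R -> R) : Prop :=
  measurable_fun D f /\ (L2norm D f < +oo)%E.

Definition W1infnorm (R : realType) (D : set R) (f : R -> R) : \bar R :=
  (Linfnorm D f + Linfnorm D (wderiv D f))%E.

Definition inW1inf (R : realType) (D : set R) (f : R -> R) : Prop :=
  weakly_derivable D f /\ (W1infnorm D f < +oo)%E.

(* [C([0,T]; X)], for the space [X] of functions satisfying [inX], normed by
   [normX]. *)
Definition curve_C0 (R : realType) (inX : (R -> R) -> Prop)
    (normX : (R -> R) -> \bar R) (T : R) (f : R -> R -> R) : Prop :=
  forall t, 0 <= t <= T ->
    inX (f t) /\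
    (fun t' => normX (fun x => f t' x - f t x)) @ within `[0, T] (nbhs t) --> 0%E.

(* [df] is the derivative of the curve [f], in the sense of difference quotients
   converging for [normX]. *)
Definition curve_derivative (R : realType) (normX : (R -> R) -> \bar R)
    (T : R) (f df : R -> R -> R) : Prop :=
  forall t, 0 <= t <= T ->
    (fun h => normX (fun x => h^-1 * (f (t + h) x - f t x) - df t x))
      @ within [set h | 0 <= t + h <= T] 0^' --> 0%E.

(* Boundary value of a function on ]-r, r[ whose continuous representative extends
   continuously to the closed interval; this is the trace for functions in H^1. *)
Definition has_trace (R : realType) (r : R) (f : R -> R) (b l : R) : Prop :=
  exists g : R -> R,
    [/\ {within `[- r, r], continuous g},
        {ae lebesgue_measure, forall x, `]- r, r[%classic x -> f x = g x} &
        g b = l].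

Definition even_extension (R : realType) (f : R -> R) (y : R) : R := f `|y|.

Definition odd_extension (R : realType) (f : R -> R) (y : R) : R :=
  Num.sg y * f `|y|.

Definition rieszW (R : realType) (s x : R) : R :=
  `|x| `^ (2 * s - 1) / (2 * s - 1).

(* The value at [x = 0] is [0]. *)
Definition rieszW' (R : realType) (s x : R) : R := x / `|x| `^ (3 - 2 * s).

Definition free_energy (R : realType) (s gam : R) (rho : R -> R) : R :=
  Rintegral lebesgue_measure setT (fun x =>
    (gam - 1)^-1 * rho x `^ gam +
    2^-1 * rho x *
      Rintegral lebesgue_measure setT (fun y => rieszW s (x - y) * rho y)).

Record admissible_density (R : realType) (gam : R) (rho : R -> R) : Prop := {
  adm_ge0 : forall x, 0 <= rho x ;
  adm_L1 : lebesgue_measure.-integrable setT (EFin \o rho) ;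
  adm_Lgam : lebesgue_measure.-integrable setT (fun x => (rho x `^ gam)%:E) ;
  adm_mass : Rintegral lebesgue_measure setT rho = 1 ;
  adm_moment : lebesgue_measure.-integrable setT (fun x => (x * rho x)%:E) ;
  adm_center : Rintegral lebesgue_measure setT (fun x => x * rho x) = 0 }.

Definition is_minimiser (R : realType) (s gam : R) (rho : R -> R) : Prop :=
  admissible_density gam rho /\
  forall rho', admissible_density gam rho' ->
    free_energy s gam rho <= free_energy s gam rho'.

(* The first two fields characterise the steady state up to a null set; the
   others, known consequences, single out its Lipschitz representative. *)
Record steady_state (R : realType) (s gam Rbar : R) (rhobar : R -> R) : Prop := {
  ss_minimiser : is_minimiser s gam rhobar ;
  ss_unique : forall rho, is_minimiser s gam rho ->
    {ae lebesgue_measure, forall x, rho x = rhobar x} ;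
  ss_even : forall x, rhobar (- x) = rhobar x ;
  ss_nonincreasing : forall x y, `|x| <= `|y| -> rhobar y <= rhobar x ;
  ss_lipschitz : exists k : R, k.-lipschitz rhobar ;
  ss_radius : 0 < Rbar ;
  ss_support : closure [set x | rhobar x != 0] = `[- Rbar, Rbar]%classic ;
  ss_smooth : forall (n : nat) (x : R), - Rbar < x < Rbar ->
    derivable (derive1n n rhobar) x 1 ;
  ss_equation : forall x : R,
    derivable (fun z => rhobar z `^ gam) x 1 /\
    derive1 (fun z => rhobar z `^ gam) x +
      rhobar x * Rintegral lebesgue_measure setT
                   (fun y => rieszW' s (x - y) * (rhobar y - rhobar x)) = 0 }.

Definition flow_extension (R : realType) (Rbar : R) (e : R -> R) (x : R) : R :=
  if x < - Rbar then - e Rbar + Rbar + x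
  else if x < 0 then - e (- x)
  else if x == 0 then 0
  else if x <= Rbar then e x
  else e Rbar - Rbar + x.

Definition dx (R : realType) (Rbar : R) (f : R -> R) : R -> R :=
  wderiv `]- Rbar, Rbar[ f.

Definition dx_ok (R : realType) (Rbar : R) (f : R -> R) : Prop :=
  weakly_derivable `]- Rbar, Rbar[ f.

Definition Phi (R : realType) (s gam Rbar : R) (rhobar e : R -> R) (x : R) : R :=
  derive1 (fun z => rhobar z `^ gam) x +
  rhobar x / dx Rbar e x *
    Rintegral lebesgue_measure setT (fun y =>
      rieszW' s (e x - flow_extension Rbar e y) *
      (rhobar y * dx Rbar e x
       - rhobar x * wderiv setT (flow_extension Rbar e) y)).

Definition pressure (R : realType) (gam Rbar : R) (rhobar e : R -> R) (x : R) : R :=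
  (rhobar x / dx Rbar e x) `^ gam - rhobar x `^ gam.

Definition viscous_stress (R : realType) (Rbar : R) (e v : R -> R) (x : R) : R :=
  dx Rbar v x / dx Rbar e x.

Definition is_velocity (R : realType) (Rbar T : R) (eta v : R -> R -> R) : Prop :=
  forall t x, 0 <= t <= T -> - Rbar <= x <= Rbar ->
    deriv_within `[0, T] (eta ^~ x) t (v t x).

(* [lagrangian_solution eta0 eta1 T eta v w]: [eta] is a strong solution on
   [0, T], with [v] and [w] its first and second time derivatives. The weight
   [rhobar] is positive on ]-Rbar, Rbar[, so that every element of L^2 can be
   written in the form [rhobar^(1/2) w]. The flow is odd in [x], in accordance
   with the even and odd extensions of the density and the velocity. *)
Record lagrangian_solution (R : realType) (s gam Rbar : R) (rhobar : R -> R)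
    (eta0 eta1 : R -> R) (T : R) (eta v w : R -> R -> R) : Prop := {
  ls_continuous : forall t, 0 <= t <= T ->
    {within `[- Rbar, Rbar], continuous (eta t)} /\
    {within `[- Rbar, Rbar], continuous (v t)} ;
  ls_odd : forall t x, 0 <= t <= T -> - Rbar <= x <= Rbar ->
    eta t (- x) = - eta t x ;
  ls_velocity : is_velocity Rbar T eta v ;
  ls_dx : forall t, 0 <= t <= T ->
    [/\ dx_ok Rbar (eta t), dx_ok Rbar (dx Rbar (eta t)),
        dx_ok Rbar (pressure gam Rbar rhobar (eta t)) &
        dx_ok Rbar (viscous_stress Rbar (eta t) (v t))] ;
  ls_bounds : exists c1 c2 : R, [/\ 0 < c1, 0 < c2 &
    forall t, 0 <= t <= T ->
      {ae lebesgue_measure, forall x, `]- Rbar, Rbar[%classic x ->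
        c1 <= dx Rbar (eta t) x <= c2}] ;
  ls_velocity_W1inf :
    curve_C0 (inW1inf `]- Rbar, Rbar[) (W1infnorm `]- Rbar, Rbar[) T v ;
  ls_velocity_L2 :
    curve_C0 (inL2 `]- Rbar, Rbar[) (L2norm `]- Rbar, Rbar[) T
      (fun t x => rhobar x `^ 2^-1 * v t x) ;
  ls_acceleration :
    curve_derivative (L2norm `]- Rbar, Rbar[) T
      (fun t x => rhobar x `^ 2^-1 * v t x)
      (fun t x => rhobar x `^ 2^-1 * w t x) ;
  ls_acceleration_L2 :
    curve_C0 (inL2 `]- Rbar, Rbar[) (L2norm `]- Rbar, Rbar[) T
      (fun t x => rhobar x `^ 2^-1 * w t x) ;
  ls_dxx_L2 :
    curve_C0 (inL2 `]- Rbar, Rbar[) (L2norm `]- Rbar, Rbar[) T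
      (fun t x => rhobar x `^ (gam - 2^-1) * dx Rbar (dx Rbar (eta t)) x) ;
  ls_viscous_L2 :
    curve_C0 (inL2 `]- Rbar, Rbar[) (L2norm `]- Rbar, Rbar[) T
      (fun t x => rhobar x `^ (- 2^-1) *
                  dx Rbar (viscous_stress Rbar (eta t) (v t)) x) ;
  ls_trace : forall t, 0 <= t <= T ->
    has_trace Rbar (dx Rbar (eta t)) Rbar 1 /\
    has_trace Rbar (dx Rbar (eta t)) (- Rbar) 1 ;
  ls_equation :
    {ae lebesgue_measure, forall t, `]0, T[%classic t ->
      {ae lebesgue_measure, forall x, `]- Rbar, Rbar[%classic x ->
        rhobar x * w t x + dx Rbar (pressure gam Rbar rhobar (eta t)) x
          + Phi s gam Rbar rhobar (eta t) x =
        dx Rbar (viscous_stress Rbar (eta t) (v t)) x}} ;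
  ls_initial : forall x, - Rbar <= x <= Rbar ->
    eta 0 x = eta0 x /\ v 0 x = eta1 x }.

Definition lagrangian_strong (R : realType) (s gam Rbar : R) (rhobar : R -> R)
    (eta0 eta1 : R -> R) (T : R) (eta : R -> R -> R) : Prop :=
  exists v w, lagrangian_solution s gam Rbar rhobar eta0 eta1 T eta v w.

Definition unique_global_lagrangian (R : realType) (s gam Rbar : R)
    (rhobar eta0 eta1 : R -> R) (eta : R -> R -> R) : Prop :=
  forall T, 0 < T ->
    lagrangian_strong s gam Rbar rhobar eta0 eta1 T eta /\
    forall eta', lagrangian_strong s gam Rbar rhobar eta0 eta1 T eta' ->
      forall t x, 0 <= t <= T -> - Rbar <= x <= Rbar -> eta' t x = eta t x.

Record initial_data (R : realType) (gam Rbar : R) (rhobar : R -> R)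
    (a0 : R) (rho0 u0 : R -> R) : Prop := {
  id_a0 : 0 < a0 ;
  id_ge0 : forall y, 0 <= y <= a0 -> 0 <= rho0 y ;
  id_integrable : lebesgue_measure.-integrable `[0, a0] (EFin \o rho0) ;
  id_mass : Rintegral lebesgue_measure `[0, a0] rho0 =
            Rintegral lebesgue_measure `[0, Rbar] rhobar ;
  id_vacuum : rho0 a0 = 0 ;
  id_slope : exists l,
    deriv_within `[0, a0] (fun y => rho0 y `^ (gam - 1)) a0 l /\
    deriv_within `[0, Rbar] (fun x => rhobar x `^ (gam - 1)) Rbar l ;
  id_u0_center : u0 0 = 0 ;
  id_u0_boundary : deriv_within `[0, a0] u0 a0 0 }.

Record lagrangian_map (R : realType) (Rbar : R) (rhobar : R -> R)
    (a0 : R) (rho0 eta0 : R -> R) : Prop := {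
  lm_range : forall x, - Rbar <= x <= Rbar -> - a0 <= eta0 x <= a0 ;
  lm_odd : forall x, - Rbar <= x <= Rbar -> eta0 (- x) = - eta0 x ;
  lm_mass : forall x, 0 <= x <= Rbar ->
    Rintegral lebesgue_measure `[eta0 (- x), eta0 x] (even_extension rho0) =
    Rintegral lebesgue_measure `[- x, x] rhobar ;
  lm_slope_right : deriv_within `[- Rbar, Rbar] eta0 Rbar 1 ;
  lm_slope_left : deriv_within `[- Rbar, Rbar] eta0 (- Rbar) 1 }.

Definition initial_velocity (R : realType) (u0 eta0 : R -> R) (x : R) : R :=
  odd_extension u0 (eta0 x).

Definition initial_acceleration (R : realType) (s gam Rbar : R)
    (rhobar eta0 eta1 : R -> R) (x : R) : R :=
  (rhobar x)^-1 *
  (- dx Rbar (pressure gam Rbar rhobar eta0) x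
   - Phi s gam Rbar rhobar eta0 x
   + dx Rbar (viscous_stress Rbar eta0 eta1) x).

(* The L^oo norm of the pair is that of its Euclidean length. *)
Definition perturbation_size (R : realType) (s gam Rbar : R)
    (rhobar eta0 eta1 : R -> R) : \bar R :=
  let I := `]- Rbar, Rbar[%classic in
  let first_order x :=
    Num.sqrt ((dx Rbar eta0 x - 1) ^+ 2 + dx Rbar eta1 x ^+ 2) in
  let second_order x :=
    rhobar x `^ (gam - 2^-1) * dx Rbar (dx Rbar eta0) x in
  let acceleration x :=
    rhobar x `^ 2^-1 * initial_acceleration s gam Rbar rhobar eta0 eta1 x in
  (Linfnorm I first_order ^+ 2 + L2norm I second_order ^+ 2
   + L2norm I acceleration ^+ 2)%E.

Definition small_perturbation (R : realType) (s gam Rbar : R)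
    (rhobar eta0 eta1 : R -> R) (eps : R) : Prop :=
  [/\ dx_ok Rbar eta0 /\ dx_ok Rbar (dx Rbar eta0), dx_ok Rbar eta1,
      dx_ok Rbar (pressure gam Rbar rhobar eta0),
      dx_ok Rbar (viscous_stress Rbar eta0 eta1) &
      (perturbation_size s gam Rbar rhobar eta0 eta1 <= eps%:E)%E].

Definition flow_inverse (R : realType) (Rbar : R) (eta : R -> R -> R)
    (tau xi : R) : R :=
  'pinv_(fun=> 0) `[- Rbar, Rbar]%classic (eta tau) xi.

Definition eulerian_boundary (R : realType) (Rbar : R) (eta : R -> R -> R)
    (t : R) : R := eta t Rbar.

Definition eulerian_density (R : realType) (Rbar : R) (rhobar : R -> R)
    (eta : R -> R -> R) (tau xi : R) : R :=
  let x := flow_inverse Rbar eta tau xi in rhobar x / dx Rbar (eta tau) x.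

Definition eulerian_velocity (R : realType) (Rbar : R) (eta v : R -> R -> R)
    (tau xi : R) : R :=
  v tau (flow_inverse Rbar eta tau xi).

(* Strong solutions of
     d_tau rho + d_xi (rho u) = 0,
     rho (d_tau u + u d_xi u) + d_xi (rho^gam) = d_xixi u - rho d_xi Psi
   for 0 < xi < a(tau), with a' = u(tau, a(tau)), a(0) = a0,
   (rho, u)(0) = (rho0, u0), u(tau, 0) = 0 and d_xi u(tau, a(tau)) = 0, are by
   definition the Eulerian descriptions of strong solutions of the Lagrangian
   problem; a0, rho0 and u0 enter through [eta0] and [eta1]. Bijectivity is what
   gives a meaning to [eta^-1(tau, xi)] for -a(tau) <= xi <= a(tau). *)
Definition fbp_strong (R : realType) (s gam Rbar : R) (rhobar eta0 eta1 : R -> R)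
    (T : R) (rho u : R -> R -> R) (a : R -> R) : Prop :=
  exists eta v : R -> R -> R,
    [/\ lagrangian_strong s gam Rbar rhobar eta0 eta1 T eta,
        is_velocity Rbar T eta v &
        forall t, 0 <= t <= T ->
          [/\ a t = eulerian_boundary Rbar eta t,
              set_bij `[- Rbar, Rbar] `[- a t, a t] (eta t) &
              {ae lebesgue_measure, forall xi, `[- a t, a t]%classic xi ->
                rho t xi = eulerian_density Rbar rhobar eta t xi /\
                u t xi = eulerian_velocity Rbar eta v t xi}]].

Definition fbp_global_strong (R : realType) (s gam Rbar : R)
    (rhobar eta0 eta1 : R -> R) (rho u : R -> R -> R) (a : R -> R) : Prop :=
  forall T, 0 < T -> fbp_strong s gam Rbar rhobar eta0 eta1 T rho u a.

(* Main.v *)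
Require Import Defs.
From mathcomp Require Import all_boot all_order all_algebra.
From mathcomp Require Import ring lra.
From mathcomp Require Import all_classical all_reals all_analysis.
From mathcomp Require Import measurable_realfun.
Import Order.TTheory GRing.Theory Num.Theory.
Import numFieldNormedType.Exports.
Local Open Scope classical_set_scope.
Local Open Scope ring_scope.

(** The Lagrangian problem is uniquely and globally solvable, and a strong
    solution of the free boundary problem is by definition the Eulerian picture
    of a Lagrangian one. What has to be shown is therefore that the change of
    variables is legitimate and that it does not lose uniqueness.

    Legitimate: each [eta t] has to map [-Rbar, Rbar] one-to-one onto
    [-a(t), a(t)]. The only pointwise information on [eta t] is continuity; the
    bound [c1 <= dx eta] holds almost everywhere for a weak derivative.
    [weak_derivative_gt0_homo] deduces strict monotonicity from it without
    passing through absolute continuity: if [f x >= f y] for some [x < y], then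
    testing the weak derivative [g] against a nonnegative function [phi] that
    climbs just after [x], stays constant, and descends just before [y] gives
    [0 <= \int f phi' = - \int g phi < 0]. Such a [phi] is written down as a
    quadratic spline ([plateau]). Surjectivity is then the intermediate value
    theorem, the endpoints being [-a(t)] and [a(t)] because [eta t] is odd
    ([lagrangian_strong_bij]).

    Unique: another strong solution comes with its own flow [eta'], and
    Lagrangian uniqueness gives [eta' = eta] on [0, T] x [-Rbar, Rbar]. Each
    ingredient of the Eulerian fields depends only on these values: the weak
    derivative ([wderiv_eq]), the inverse map, by bijectivity
    ([flow_inverse_eq]), and the velocity, as a limit of difference quotients in
    time ([deriv_within_unique]). *)

Set Implicit Arguments.
Unset Strict Implicit.

(** * Quadratic splines *)

Lemma quadratic_remainder_is_derive (R : realType) (F : R -> R) (x l C : R) :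
  (forall h, `|F (x + h) - F x - h * l| <= C * h ^+ 2) ->
  is_derive x (1 : R) F l.
Proof.
move=> FC.
have C0 : 0 <= C by have := FC 1; rewrite expr1n mulr1; exact: le_trans.
have cvgF :
  (fun h => h^-1 *: ((F \o shift x) (h *: (1 : R)) - F x)) @ 0^' --> l.
  apply/cvgrPdist_le => /= e e0.
  near=> h.
  have h0 : h != 0 by near: h; exact: nbhs_dnbhs_neq.
  rewrite /= (_ : l - _ = - h^-1 * (F (x + h) - F x - h * l)); last first.
    by rewrite /= [h *: _]mulr1 [h + x]addrC /GRing.scale /=; field.
  rewrite normrM normrN normfV ler_pdivrMl ?normr_gt0//.
  apply: (le_trans (FC h)); rewrite -real_normK ?num_real// expr2 mulrA mulrC.
  rewrite ler_pM2l ?normr_gt0//.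
  (* [C] may vanish, so [C + 1] is the divisor of [e]. *)
  apply: (@le_trans _ _ (`|h| * (C + 1))).
    by rewrite mulrC ler_wpM2l// lerDl.
  rewrite -ler_pdivlMr ?ltr_wpDl//.
  near: h; apply: nbhs_dnbhs; apply: (@nbhs0_le R R).
  by rewrite divr_gt0// ltr_wpDl.
by apply: DeriveDef; [apply/cvg_ex; exists l | exact: cvg_lim].
Unshelve. all: by end_near. Qed.

Definition ramp {R : realType} (t : R) : R := Num.max t 0.

Lemma ramp_cases (R : realType) (t : R) :
  t <= 0 /\ ramp t = 0 \/ 0 < t /\ ramp t = t.
Proof. by rewrite /ramp maxEle; case: leP => ?; [left|right]. Qed.

Lemma continuous_ramp (R : realType) : continuous (@ramp R).
Proof.
by move=> x; apply: (@continuous_max R R (fun t => t) (fun=> 0));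
  [exact: cvg_id | exact: cvg_cst].
Qed.

Lemma ramp_sqr_remainder (R : realType) (t h : R) :
  `|ramp (t + h) ^+ 2 - ramp t ^+ 2 - h * (2 * ramp t)| <= h ^+ 2.
Proof.
have := sqr_ge0 h; have := sqr_ge0 (t + h); rewrite ler_norml !expr2 => ? ?.
have [[? ->]|[? ->]] := ramp_cases (t + h);
  have [[? ->]|[? ->]] := ramp_cases t; apply/andP; split; nra.
Qed.

(** Up to the factor [2 * d ^+ 2], a C^1 step from 0 to 1 over [0, 2 * d]: the
    quadratic B-spline combination of the truncated powers at [0], [d] and
    [2 * d]. *)
Definition step {R : realType} (d t : R) : R :=
  ramp t ^+ 2 - 2 * ramp (t - d) ^+ 2 + ramp (t - 2 * d) ^+ 2.

Definition hat {R : realType} (d t : R) : R :=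
  2 * ramp t - 4 * ramp (t - d) + 2 * ramp (t - 2 * d).

Ltac split_ramps t d :=
  have [[? ->]|[? ->]] := ramp_cases t;
  have [[? ->]|[? ->]] := ramp_cases (t - d);
  have [[? ->]|[? ->]] := ramp_cases (t - 2 * d).

(** A quadratic bound uniform in [t] yields the derivative of [step] everywhere,
    without a separate discussion of the knots. *)
Lemma step_remainder (R : realType) (d t h : R) :
  `|step d (t + h) - step d t - h * hat d t| <= 4 * h ^+ 2.
Proof.
have := ramp_sqr_remainder t h.
have := ramp_sqr_remainder (t - d) h.
have := ramp_sqr_remainder (t - 2 * d) h.
rewrite /step /hat (addrAC t h) (addrAC t h).
rewrite !ler_norml => /andP[? ?] /andP[? ?] /andP[? ?].
apply/andP; split; lra.
Qed.

Lemma step_le0 (R : realType) (d t : R) : 0 < d -> t <= 0 -> step d t = 0.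
Proof. by move=> ? ?; rewrite /step; split_ramps t d; nra. Qed.

Lemma step_ge (R : realType) (d t : R) :
  0 < d -> 2 * d <= t -> step d t = 2 * d ^+ 2.
Proof. by move=> ? ?; rewrite /step; split_ramps t d; nra. Qed.

Lemma step_itv (R : realType) (d t : R) :
  0 < d -> 0 <= step d t <= 2 * d ^+ 2.
Proof.
move=> d0; rewrite /step.
have := sqr_ge0 t; have := sqr_ge0 (t - d); have := sqr_ge0 (t - 2 * d).
rewrite !expr2 => ? ? ?.
apply/andP; split; split_ramps t d; nra.
Qed.

Lemma hat_ge0 (R : realType) (d t : R) : 0 < d -> 0 <= hat d t.
Proof. by move=> ?; rewrite /hat; split_ramps t d; lra. Qed.

Lemma hat_le0_eq0 (R : realType) (d t : R) : 0 < d -> t <= 0 -> hat d t = 0.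
Proof. by move=> ? ?; rewrite /hat; split_ramps t d; lra. Qed.

Lemma hat_ge_eq0 (R : realType) (d t : R) :
  0 < d -> 2 * d <= t -> hat d t = 0.
Proof. by move=> ? ?; rewrite /hat; split_ramps t d; lra. Qed.

(** * Plateau test functions *)

(** The test function that compares the values of [f] near [p] and near [q]: its
    derivative is a positive bump on [p, p + 2 * d] and the opposite bump on
    [q, q + 2 * d]. *)
Definition plateau {R : realType} (p q d z : R) : R :=
  step d (z - p) - step d (z - q).

Lemma plateau_is_derive (R : realType) (p q d z : R) :
  is_derive z (1 : R) (plateau p q d) (hat d (z - p) - hat d (z - q)).
Proof.
apply: (@quadratic_remainder_is_derive _ _ _ _ 8) => h.
have := step_remainder d (z - p) h.
have := step_remainder d (z - q) h.
rewrite /plateau (addrAC z h) (addrAC z h).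
rewrite !ler_norml => /andP[? ?] /andP[? ?].
apply/andP; split; lra.
Qed.

Lemma derive1_plateau (R : realType) (p q d : R) :
  derive1 (plateau p q d) = (fun z => hat d (z - p) - hat d (z - q)).
Proof.
apply/funext => z; rewrite derive1E.
exact: (@derive_val _ _ _ _ _ _ _ (plateau_is_derive p q d z)).
Qed.

Lemma continuous_derive1_plateau (R : realType) (p q d : R) :
  continuous (derive1 (plateau p q d)).
Proof.
have hatC r : continuous (fun z => hat d (z - r)).
  have rampC e : continuous (fun z => ramp (z - r - e)).
    move=> x; apply: (@continuous_comp _ _ _ (fun z => z - r - e) ramp).
      by do 2 (apply: cvgB; last exact: cvg_cst); exact: cvg_id.
    exact: continuous_ramp.
  move=> x; apply: cvgD; last by apply: cvgMr; exact: rampC.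
  apply: cvgB; last by apply: cvgMr; exact: rampC.
  apply: cvgMr; have := rampC 0 x; rewrite /continuous_at subr0.
  by under eq_fun do rewrite subr0.
rewrite derive1_plateau => x.
by apply: cvgB; exact: hatC.
Qed.

Lemma continuous_plateau (R : realType) (p q d : R) :
  continuous (plateau p q d).
Proof.
move=> x; apply: differentiable_continuous; apply/derivable1_diffP.
exact: (@ex_derive _ _ _ _ _ _ _ (plateau_is_derive p q d x)).
Qed.

Lemma plateau_ge0 (R : realType) (p q d : R) :
  0 < d -> p + 2 * d <= q -> forall z, 0 <= plateau p q d z.
Proof.
move=> d0 pq z.
rewrite /plateau subr_ge0; have [zp|zp] := leP (p + 2 * d) z.
  rewrite [leRHS]step_ge//; last by lra.
  by have /andP[] := step_itv (z - q) d0.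
rewrite [leLHS]step_le0//; last by lra.
by have /andP[] := step_itv (z - p) d0.
Qed.

Lemma plateau_top (R : realType) (p q d : R) : 0 < d ->
  forall z, p + 2 * d <= z <= q -> plateau p q d z = 2 * d ^+ 2.
Proof.
by move=> ? z /andP[? ?]; rewrite /plateau step_ge ?step_le0 ?subr0//; lra.
Qed.

Lemma plateau_support (R : realType) (p q d : R) :
  0 < d -> p + 2 * d <= q ->
  forall z, ~ `[p, q + 2 * d]%classic z -> plateau p q d z = 0.
Proof.
move=> d0 pq z.
move/negP; rewrite /= in_itv/= negb_and -!ltNge /plateau => /orP[zp|zq].
  by rewrite !step_le0 ?subr0//; lra.
by rewrite !step_ge ?subrr//; lra.
Qed.

Lemma derive1_plateau_support (R : realType) (p q d : R) :
  0 < d -> p + 2 * d <= q ->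
  forall z, ~ `[p, q + 2 * d]%classic z -> derive1 (plateau p q d) z = 0.
Proof.
move=> d0 pq z; rewrite derive1_plateau.
move/negP; rewrite /= in_itv/= negb_and -!ltNge => /orP[zp|zq].
  by rewrite !hat_le0_eq0 ?subr0//; lra.
by rewrite !hat_ge_eq0 ?subrr//; lra.
Qed.

Lemma plateau_test_function (R : realType) (a b p q d : R) :
  0 < d -> p + 2 * d <= q -> a < p -> q + 2 * d < b ->
  test_function `]a, b[ (plateau p q d).
Proof.
move=> d0 pq ap qb; split.
- move=> x; exact: (@ex_derive _ _ _ _ _ _ _ (plateau_is_derive p q d x)).
- exact: continuous_derive1_plateau.
- exists `[p, q + 2 * d]%classic; split.
  + exact: segment_compact.
  + by move=> x /=; rewrite !in_itv/= => /andP[? ?]; apply/andP; split; lra.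
  + exact: plateau_support.
Qed.

(** [f] lies above [m] where the plateau climbs and below [m] where it
    descends, so [(f - m) * plateau'] has a sign. *)
Lemma plateau_slope_weight (R : realType) (f : R -> R) (m p q d : R) :
  0 < d -> p + 2 * d <= q ->
  (forall z, p <= z <= p + 2 * d -> m <= f z) ->
  (forall z, q <= z <= q + 2 * d -> f z <= m) ->
  forall z, m * derive1 (plateau p q d) z <= f z * derive1 (plateau p q d) z.
Proof.
move=> d0 pq fp fq z; rewrite derive1_plateau -subr_ge0 -mulrBl.
have [zp|zp] := boolP (p <= z <= p + 2 * d).
  rewrite [hat d (z - q)]hat_le0_eq0//; last by lra.
  by rewrite subr0 mulr_ge0 ?hat_ge0// subr_ge0 fp.
have -> : hat d (z - p) = 0.
  move: zp; rewrite negb_and -!ltNge => /orP[?|?].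
    by rewrite hat_le0_eq0//; lra.
  by rewrite hat_ge_eq0//; lra.
have [zq|zq] := boolP (q <= z <= q + 2 * d).
  by rewrite sub0r mulrN -mulNr mulr_ge0 ?hat_ge0// oppr_ge0 subr_le0 fq.
have -> : hat d (z - q) = 0.
  move: zq; rewrite negb_and -!ltNge => /orP[?|?].
    by rewrite hat_le0_eq0//; lra.
  by rewrite hat_ge_eq0//; lra.
by rewrite subrr mulr0.
Qed.

(** * Integration against plateaus *)

Lemma ae_implies (R : realType) (P Q : R -> Prop) : (forall x, P x -> Q x) ->
  {ae lebesgue_measure, forall x, P x} -> {ae lebesgue_measure, forall x, Q x}.
Proof.
move=> PQ; apply: filterS => //.
exact: (ae_filter_ringOfSetsType lebesgue_measure).
Qed.

Lemma Rintegral_restrict (R : realType) (D K : set R) (h : R -> R) :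
  K `<=` D -> (forall x, ~ K x -> h x = 0) ->
  Rintegral lebesgue_measure D h = Rintegral lebesgue_measure K h.
Proof.
move=> KD hK; rewrite Rintegral_mkcond [RHS]Rintegral_mkcond.
apply: eq_Rintegral => x _; rewrite !patchE.
case: ifPn => xD; case: ifPn => xK //.
  by apply: hK => Kx; move: xK; rewrite mem_set.
by move: xD; rewrite mem_set//; apply: KD; rewrite inE in xK.
Qed.

(** The constant [m] integrates to zero against the derivative of a compactly
    supported function, so only the signed part [(f - m) * plateau'] counts. *)
Lemma plateau_slope_Rintegral_ge0 (R : realType) (f : R -> R) (m p q d : R) :
  0 < d -> p + 2 * d <= q ->
  {within `[p, q + 2 * d], continuous f} ->
  (forall z, p <= z <= p + 2 * d -> m <= f z) ->
  (forall z, q <= z <= q + 2 * d -> f z <= m) ->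
  0 <= Rintegral lebesgue_measure `[p, q + 2 * d]
         (fun x => f x * derive1 (plateau p q d) x).
Proof.
move=> d0 pq fC fp fq; set K := `[p, q + 2 * d]%classic.
have pK : p < q + 2 * d by lra.
have mK : measurable K by exact: measurable_itv.
have cptK : compact K by exact: segment_compact.
have dC := @continuous_derive1_plateau R p q d.
have dCK : {within K, continuous (derive1 (plateau p q d))}
  by exact: continuous_subspaceT.
have int_d : lebesgue_measure.-integrable K (EFin \o derive1 (plateau p q d))
  by exact: continuous_compact_integrable.
have m0 : Rintegral lebesgue_measure K
    (fun x => m * derive1 (plateau p q d) x) = 0.
  rewrite RintegralZl//.
  rewrite [X in m * X](_ : _ = 0) ?mulr0// /Rintegral.
  rewrite (@continuous_FTC2 _ _ (plateau p q d))//; last first.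
    split.
    + by move=> x _; apply: ex_derive; exact: plateau_is_derive.
    + by apply: cvg_at_right_filter; exact: continuous_plateau.
    + by apply: cvg_at_left_filter; exact: continuous_plateau.
  rewrite /plateau /= [step _ (p - p)]step_le0 ?subrr//.
  rewrite [step _ (p - q)]step_le0//; last by lra.
  by rewrite !step_ge//; lra.
rewrite -m0; apply: le_Rintegral => //.
- apply: continuous_compact_integrable => //.
  by apply: continuous_subspaceT => x; apply: cvgMr; exact: dC.
- apply: continuous_compact_integrable => // x.
  apply: continuousM; [exact: fC|exact: dCK].
- by move=> x _; exact: plateau_slope_weight.
Qed.

(** [g] is bounded below by [c] almost everywhere, and the plateau takes its top
    value on the nondegenerate interval [p + 2 * d, q]. *)
Lemma plateau_Rintegral_gt0 (R : realType) (g : R -> R) (c p q d : R) :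
  0 < d -> p + 2 * d < q -> 0 < c ->
  lebesgue_measure.-integrable `[p, q + 2 * d] (EFin \o g) ->
  {ae lebesgue_measure, forall x, `[p, q + 2 * d]%classic x -> c <= g x} ->
  0 < Rintegral lebesgue_measure `[p, q + 2 * d]
        (fun x => g x * plateau p q d x).
Proof.
move=> d0 pq c0 ig cg; set K := `[p, q + 2 * d]%classic in ig cg *.
have pq' := ltW pq.
have mK : measurable K by exact: measurable_itv.
have phiC : {within K, continuous (plateau p q d)}.
  by apply: continuous_subspaceT; exact: continuous_plateau.
have mphi : measurable_fun K (plateau p q d).
  apply: measurable_funTS; apply: continuous_measurable_fun.
  exact: continuous_plateau.
have igphi : lebesgue_measure.-integrable K
    (EFin \o (fun x => g x * plateau p q d x)).
  apply: (@integrableMl _ _ _ lebesgue_measure K mK (EFin \o g)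
    (plateau p q d)) => //.
  have cptK : compact K by exact: segment_compact.
  have := @compact_bounded _ _ _ (continuous_compact phiC cptK).
  by move=> [M [Mr MP]]; exists M; split => // x /MP H y Ky; apply: H; exists y.
have mg : measurable_fun K g.
  by apply/measurable_EFinP; exact: measurable_int ig.
have key : (0 < \int[lebesgue_measure]_(x in K) (g x * plateau p q d x)%:E)%E.
  (* Unlike [g], its absolute value is nonnegative at every point, as the
     comparison of nonnegative integrals requires. *)
  have -> : (\int[lebesgue_measure]_(x in K) (g x * plateau p q d x)%:E =
             \int[lebesgue_measure]_(x in K) (`|g x| * plateau p q d x)%:E)%E.
    apply: ae_eq_integral => //.
  - exact: measurable_int igphi.
  - apply/measurable_EFinP; apply: measurable_funM => //.
    by apply: measurableT_comp.
  - apply: ae_implies cg => x cg Kx; rewrite ger0_norm//.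
    by apply: le_trans (cg Kx); exact: ltW.
  pose J := `[p + 2 * d, q]%classic.
  have mJ : measurable J by exact: measurable_itv.
  apply: (@lt_le_trans _ _
    (\int[lebesgue_measure]_(x in J) (c * (2 * d ^+ 2))%:E)%E).
    rewrite /J integral_cst//= lebesgue_measure_itv/= lte_fin pq.
    rewrite -EFinD -EFinM lte_fin mulr_gt0 ?subr_gt0//.
    by rewrite !mulr_gt0// exprn_gt0.
  apply: (@le_trans _ _
    (\int[lebesgue_measure]_(x in K) (c * plateau p q d x)%:E)%E).
    have -> : (\int[lebesgue_measure]_(x in J) (c * (2 * d ^+ 2))%:E =
               \int[lebesgue_measure]_(x in J) (c * plateau p q d x)%:E)%E.
      by apply: eq_integral => x; rewrite inE /J /= in_itv/= => xpq;
        rewrite plateau_top.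
    apply: ge0_subset_integral => //.
    - by apply/measurable_EFinP; apply: measurable_funM.
    - by move=> x _; rewrite lee_fin mulr_ge0 ?plateau_ge0// ltW.
    - move=> x /=; rewrite /J /K /= !in_itv/= => /andP[? ?].
      by apply/andP; split; lra.
  apply: ae_ge0_le_integral => //.
  - by move=> x _; rewrite lee_fin mulr_ge0 ?plateau_ge0// ltW.
  - by apply/measurable_EFinP; apply: measurable_funM.
  - by move=> x _; rewrite lee_fin mulr_ge0 ?plateau_ge0.
  - apply/measurable_EFinP; apply: measurable_funM => //.
    by apply: measurableT_comp.
  - apply: ae_implies cg => x cg Kx; rewrite lee_fin ler_wpM2r ?plateau_ge0//.
    exact: le_trans (cg Kx) (ler_norm _).
rewrite /Rintegral fine_gt0// key/=.
have : (\int[lebesgue_measure]_(x in K) (g x * plateau p q d x)%:E)%E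
    \is a fin_num by apply: integrable_fin_num.
by rewrite fin_numElt => /andP[].
Qed.

(** * Continuous functions with a positive weak derivative *)

(** Testing with the plateau gives [0 <= \int f phi' = - \int g phi < 0]. *)
Lemma weak_derivative_no_drop (R : realType) (f g : R -> R)
    (a b c p q d m : R) :
  is_weak_derivative `]a, b[ f g -> 0 < c ->
  {ae lebesgue_measure, forall x, `]a, b[%classic x -> c <= g x} ->
  {within `[a, b], continuous f} ->
  0 < d -> a < p -> p + 2 * d < q -> q + 2 * d < b ->
  (forall z, p <= z <= p + 2 * d -> m <= f z) ->
  (forall z, q <= z <= q + 2 * d -> f z <= m) ->
  False.
Proof.
move=> [_ [mg _ locg] fg] c0 cg fC d0 ap pq qb fp fq.
have KD : `[p, q + 2 * d] `<=` `]a, b[.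
  by move=> x /=; rewrite !in_itv/= => /andP[? ?]; apply/andP; split; lra.
have := fg _ (plateau_test_function d0 (ltW pq) ap qb).
rewrite (Rintegral_restrict KD); last first.
  by move=> x xK; rewrite derive1_plateau_support ?mulr0// ltW.
rewrite (Rintegral_restrict KD); last first.
  by move=> x xK; rewrite plateau_support ?mulr0// ltW.
have : 0 <= Rintegral lebesgue_measure `[p, q + 2 * d]
         (fun x => f x * derive1 (plateau p q d) x).
  apply: (@plateau_slope_Rintegral_ge0 _ _ m) => //; first exact: ltW.
  apply: continuous_subspaceW fC => x /KD /=.
  by rewrite !in_itv/= => /andP[/ltW -> /ltW ->].
have : 0 < Rintegral lebesgue_measure `[p, q + 2 * d]
             (fun x => g x * plateau p q d x).
  apply: (plateau_Rintegral_gt0 d0 pq c0).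
    apply/integrableP; split.
      by apply/measurable_EFinP; apply: measurable_funS mg.
    exact: (locg _ KD (@segment_compact _ _ _)).
  by apply: ae_implies cg => x cg /KD.
by lra.
Qed.

Lemma within_continuous_dist (R : realType) (A : set R) (f : R -> R) (x e : R) :
  {within A, continuous f} -> A x -> 0 < e ->
  exists2 r : R, 0 < r & forall z, A z -> `|z - x| < r -> `|f z - f x| < e.
Proof.
move=> /subspace_continuousP fC Ax e0.
have /cvgrPdist_lt /(_ e e0) := fC x Ax.
rewrite near_withinE => /nbhs_ballP[r /= r0 rP]; exists r => // z Az zx.
by rewrite distrC; apply: rP => //; rewrite /ball/= distrC.
Qed.

(** The two bumps are placed inside ]x, y[, at distance [d] from [x] and [y], so
    that [x] and [y] may be the endpoints of the interval. A strict drop leaves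
    room for a level [m] between the values near [x] and near [y]; if
    [f x = f y], weak monotonicity makes [f] constant in between, and [m] is
    that constant. *)
Lemma weak_derivative_gt0_homo (R : realType) (f g : R -> R) (a b c : R) :
  is_weak_derivative `]a, b[ f g -> 0 < c ->
  {ae lebesgue_measure, forall x, `]a, b[%classic x -> c <= g x} ->
  {within `[a, b], continuous f} ->
  {in `[a, b] &, {homo f : x y / x < y}}.
Proof.
move=> fg c0 cg fC.
have mono x y : a <= x -> x < y -> y <= b -> f x <= f y.
  move=> ax xy yb; rewrite leNgt; apply/negP => fyx.
  pose e := (f x - f y) / 2.
  have e0 : 0 < e by rewrite /e; lra.
  have xI : `[a, b]%classic x by rewrite /= in_itv/= ax; lra.
  have yI : `[a, b]%classic y by rewrite /= in_itv/= yb andbT; lra.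
  have [r r0 rP] := within_continuous_dist fC xI e0.
  have [r' r'0 r'P] := within_continuous_dist fC yI e0.
  have [d d0 [dr dr' dxy]] : exists2 d : R, 0 < d &
      [/\ 8 * d <= r, 8 * d <= r' & 8 * d <= y - x].
    exists (Num.min (y - x) (Num.min r r') / 8).
      by rewrite divr_gt0// !lt_min subr_gt0 xy r0.
    by rewrite mulrC divfK//; split; rewrite !ge_min lexx ?orbT.
  apply: (@weak_derivative_no_drop _ f g a b c (x + d) (y - 3 * d) d
    ((f x + f y) / 2)) => //; try lra.
    move=> z /andP[? ?]; have := rP z.
    rewrite /= in_itv/= !ltr_norml /e => H.
    by have /andP[? _] : - ((f x - f y) / 2) < f z - f x < (f x - f y) / 2;
      [apply: H; apply/andP; split|]; lra.
  move=> z /andP[? ?]; have := r'P z.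
  rewrite /= in_itv/= !ltr_norml /e => H.
  by have /andP[_ ?] : - ((f x - f y) / 2) < f z - f y < (f x - f y) / 2;
    [apply: H; apply/andP; split|]; lra.
move=> x y; rewrite !in_itv/= => /andP[ax xb] /andP[ay yb] xy.
rewrite lt_neqAle mono// andbT; apply/eqP => fxy.
have cst z : x < z < y -> f z = f x.
  move=> /andP[xz zy]; apply/le_anti; rewrite {1}fxy !mono//; lra.
pose d := (y - x) / 8.
have d0 : 0 < d by rewrite /d; lra.
have dE : 8 * d = y - x by rewrite /d; lra.
apply: (@weak_derivative_no_drop _ f g a b c (x + d) (y - 3 * d) d (f x)) => //;
  try lra; move=> z /andP[? ?]; rewrite cst//; apply/andP; split; lra.
Qed.

(** * Locality of weak and one-sided derivatives *)

Lemma is_weak_derivative_eq (R : realType) (D : set R) (f f' g : R -> R) :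
  (forall x, D x -> f x = f' x) ->
  is_weak_derivative D f g -> is_weak_derivative D f' g.
Proof.
move=> ff' [[mf oD locf] locg fg]; split=> //.
- split=> //.
    by apply: eq_measurable_fun mf => x; rewrite inE => /ff'.
  move=> K KD cK.
  have <- : (\int[lebesgue_measure]_(x in K) `|f x|%:E =
             \int[lebesgue_measure]_(x in K) `|f' x|%:E)%E.
    by apply: eq_integral => x; rewrite inE => /KD /ff' ->.
  exact: locf.
- move=> phi /fg <-; apply: eq_Rintegral => x; rewrite inE => /ff'.
  by move=> ->.
Qed.

(** The chosen representative is the same function, not just equal up to a null
    set, because both choices are made in the same set of candidates. *)
Lemma wderiv_eq (R : realType) (D : set R) (f f' : R -> R) :
  (forall x, D x -> f x = f' x) -> wderiv D f = wderiv D f'.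
Proof.
move=> ff'; rewrite /wderiv; congr xget; apply/seteqP; split=> g /=.
  exact: is_weak_derivative_eq.
by apply: is_weak_derivative_eq => x /ff'.
Qed.

Lemma weakly_derivableP (R : realType) (D : set R) (f : R -> R) :
  weakly_derivable D f -> is_weak_derivative D f (wderiv D f).
Proof. by move=> [g fg]; exact: (xgetPex (fun=> 0 : R) (ex_intro _ g fg)). Qed.

(** Since [x < T], the right neighbourhood of [0] suffices to identify the
    limit of the difference quotients. *)
Lemma deriv_within_unique (R : realType) (T x l l' : R) (f f' : R -> R) :
  0 <= x < T -> (forall y, 0 <= y <= T -> f y = f' y) ->
  deriv_within `[0, T] f x l -> deriv_within `[0, T] f' x l' -> l = l'.
Proof.
move=> /andP[x0 xT] ff' fl fl'.
have right_of_0 : \forall h \near (0 : R)^'+, 0 <= x + h <= T.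
  have Tx : 0 < T - x by rewrite subr_gt0.
  near=> h.
  have h0 : 0 < h by near: h; exact: nbhs_right_gt.
  have hT : h < T - x by near: h; exact: nbhs_right_lt.
  by apply/andP; split; lra.
have sub : (0 : R)^'+ `=>` within [set h | `[0, T]%classic (x + h)] 0^'.
  move=> A; rewrite /within /= => A0.
  have {}A0 : \forall h \near (0 : R)^'+, 0 <= x + h <= T -> A h.
    move: A0; rewrite !near_withinE /=; apply: filterS => h Ah h0 hT.
    by apply: Ah; [rewrite gt_eqF|rewrite in_itv].
  by apply: filterS2 right_of_0 A0 => h hT; apply.
have {}fl := cvg_trans (cvg_app _ sub) fl.
have {}fl' := cvg_trans (cvg_app _ sub) fl'.
apply: (cvg_unique (@norm_hausdorff _ _) fl); apply: cvg_trans fl'.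
apply: near_eq_cvg; apply: filterS right_of_0 => h hT.
by rewrite !ff'// x0 ltW.
Unshelve. all: by end_near. Qed.

(** * The flow map and its inverse *)

Lemma lagrangian_strong_bij (R : realType) (s gam Rbar T t : R)
    (rhobar eta0 eta1 : R -> R) (eta : R -> R -> R) : 0 < Rbar ->
  lagrangian_strong s gam Rbar rhobar eta0 eta1 T eta -> 0 <= t <= T ->
  set_bij `[- Rbar, Rbar] `[- eta t Rbar, eta t Rbar] (eta t).
Proof.
move=> R0 [v [w sol]] tT.
have [etaC _] := ls_continuous sol tT.
have [/weakly_derivableP d_eta _ _ _] := ls_dx sol tT.
have [c1 [c2 [c10 c20 /(_ t tT) bounds]]] := ls_bounds sol.
have incr : {in `[- Rbar, Rbar] &, {homo eta t : x y / x < y}}.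
  apply: (weak_derivative_gt0_homo d_eta c10) => //.
  by apply: ae_implies bounds => x H /H /andP[].
have homo := ltW_homo_in incr.
have RR : - Rbar <= Rbar by lra.
have etaN : eta t (- Rbar) = - eta t Rbar by rewrite (ls_odd sol)// RR lexx.
have RinI : Rbar \in `[- Rbar, Rbar] by rewrite in_itv/= RR lexx.
have NRinI : - Rbar \in `[- Rbar, Rbar] by rewrite in_itv/= lexx RR.
split.
- move=> x xI; rewrite /= in_itv/= -etaN.
  have /andP[? ?] := xI.
  by apply/andP; split; apply: homo.
- move=> x y; rewrite !inE => xI yI exy.
  have [xy|yx|//] := ltgtP x y.
    by have := incr _ _ xI yI xy; rewrite exy ltxx.
  by have := incr _ _ yI xI yx; rewrite exy ltxx.
- move=> xi; rewrite /= in_itv/= => xiI.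
  have mono : eta t (- Rbar) <= eta t Rbar by exact: homo.
  have [|x xI <-] := IVT RR etaC (v := xi); last by exists x.
  by rewrite etaN in mono *; rewrite minEle maxEle mono.
Qed.

(** [flow_inverse] chooses a preimage; injectivity makes the choice independent
    of everything but the values of the flow on [-Rbar, Rbar]. *)
Lemma flow_inverse_eq (R : realType) (Rbar : R) (eta eta' : R -> R -> R)
    (a t xi : R) :
  (forall x, - Rbar <= x <= Rbar -> eta' t x = eta t x) ->
  set_bij `[- Rbar, Rbar] `[- a, a] (eta t) ->
  `[- a, a]%classic xi ->
  flow_inverse Rbar eta' t xi = flow_inverse Rbar eta t xi /\
  - Rbar <= flow_inverse Rbar eta t xi <= Rbar.
Proof.
move=> ee' bij xiI.
have [_ inj surj] := bij.
have surj' : set_surj `[- Rbar, Rbar]%classic `[- a, a]%classic (eta' t).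
  move=> y /surj[x xI <-]; exists x => //; apply: ee'; exact: xI.
have inv_in e (se : set_surj `[- Rbar, Rbar]%classic `[- a, a]%classic
    (e t)) :
    `[- Rbar, Rbar]%classic (flow_inverse Rbar e t xi).
  by apply: (surjpinv_image_sub se); exists xi.
have inv_K e (se : set_surj `[- Rbar, Rbar]%classic `[- a, a]%classic
    (e t)) :
    e t (flow_inverse Rbar e t xi) = xi.
  by rewrite /flow_inverse (surjpK (fun=> 0) se) ?inE.
split; last by have := inv_in _ surj; rewrite /= in_itv.
apply: inj; rewrite ?inE; [exact: inv_in|exact: inv_in|].
rewrite inv_K// -ee' ?inv_K//.
by have := inv_in _ surj'; rewrite /= in_itv.
Qed.

Unset Implicit Arguments.
Set Strict Implicit.

Theorem theorem2p2 (R : realType) (s gam : R)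
  (hs : 3 / 8 < s < 1 / 2) (hgam : 2 * (1 - s) < gam < 1 + 2 * s / 3)
  (Rbar : R) (rhobar : R -> R) (hbar : steady_state s gam Rbar rhobar) :
  exists2 eps0 : R, 0 < eps0 &
  forall (a0 : R) (rho0 u0 eta0 : R -> R),
    initial_data gam Rbar rhobar a0 rho0 u0 ->
    lagrangian_map Rbar rhobar a0 rho0 eta0 ->
    let eta1 := initial_velocity u0 eta0 in
    small_perturbation s gam Rbar rhobar eta0 eta1 eps0 ->
    forall eta v : R -> R -> R,
      unique_global_lagrangian s gam Rbar rhobar eta0 eta1 eta ->
      (forall T, 0 < T -> is_velocity Rbar T eta v) ->
      let a := eulerian_boundary Rbar eta in
      let rho := eulerian_density Rbar rhobar eta in
      let u := eulerian_velocity Rbar eta v in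
      fbp_global_strong s gam Rbar rhobar eta0 eta1 rho u a /\
      forall (rho' u' : R -> R -> R) (a' : R -> R),
        fbp_global_strong s gam Rbar rhobar eta0 eta1 rho' u' a' ->
        forall t, 0 <= t ->
          a' t = a t /\
          {ae lebesgue_measure, forall xi, `[- a t, a t]%classic xi ->
            rho' t xi = rho t xi /\ u' t xi = u t xi}.
Proof.
have R0 := ss_radius hbar.
exists 1 => // a0 rho0 u0 eta0 _ _ eta1 _ eta v eta_uniq v_vel a rho u.
split=> [T T0|rho' u' a' sol' t t0].
  have [strong _] := eta_uniq T T0.
  exists eta, v; split=> //; first exact: v_vel.
  move=> t tT; split=> //; first exact: lagrangian_strong_bij strong tT.
  by apply: aeW.
(* [t] has to be smaller than the time horizon, so that [v t] is determined by
   later values of [eta]. *)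
have T0 : 0 < t + 1 by lra.
have tT : 0 <= t <= t + 1 by apply/andP; split; lra.
have tT' : 0 <= t < t + 1 by apply/andP; split; lra.
have [strong uniq] := eta_uniq _ T0.
have [eta' [v' [strong' v'_vel /(_ t tT)[-> _ ae_eq]]]] := sol' _ T0.
have {}uniq := uniq _ strong'.
have bij := lagrangian_strong_bij R0 strong tT.
have endp : - Rbar <= Rbar <= Rbar by apply/andP; split; lra.
have a_eq : eulerian_boundary Rbar eta' t = a t by exact: uniq.
split=> //.
have dx_eq : dx Rbar (eta' t) = dx Rbar (eta t).
  apply: wderiv_eq => x; rewrite /= in_itv/= => /andP[? ?].
  by apply: uniq => //; apply/andP; split; exact: ltW.
have v_eq x : - Rbar <= x <= Rbar -> v' t x = v t x.
  move=> xI; apply: (deriv_within_unique tT' _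
    (v'_vel _ _ tT xI) (v_vel _ T0 _ _ tT xI)).
  by move=> y yT; exact: uniq.
apply: ae_implies ae_eq => xi xi_eq xiI.
rewrite a_eq in xi_eq.
have [-> ->] := xi_eq xiI.
have [inv_eq invI] := flow_inverse_eq (fun x => uniq t x tT) bij xiI.
by rewrite /rho /u /eulerian_density /eulerian_velocity inv_eq dx_eq v_eq.
Qed.
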